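(* Let $n,k$ be positive integers with $k\geqslant n$, and let $F(x_1,\ldots,x_n)\in\mathbb{Q}[x_1,\ldots,x_n]$ be a polynomial (not necessarily symmetric) of degree $r$. Then $$\sum_{\substack{k_1+\cdots+k_n=k\\ k_j\geqslant 1}}F(k_1,\ldots,k_n)\zeta(2k_1)\cdots\zeta(2k_n)=\sum_{l=0}^{\min\{T,k\}}e_{F,l}(k)\zeta(2l)\zeta(2k-2l),$$ where $T=\max\{[(r+n-2)/2],[(n-1)/2]\}$ and $e_{F,l}(x)\in\mathbb{Q}[x]$ are polynomials depending only on $l$ and $F$ (not on $k$), with $\deg e_{F,l}(x)\leqslant r+n-2l-1$.
   Context: $\zeta$ is the Riemann zeta function, with $\zeta(0)=-\frac12$; $[x]$ is the greatest integer not exceeding $x$. *)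

(* Defs.v *)
From mathcomp Require Import all_boot all_order all_algebra.
From mathcomp Require Import mpoly.
From mathcomp Require Import reals topology normedtype sequences.

Set Implicit Arguments.
Unset Strict Implicit.
Unset Printing Implicit Defensive.

Import Order.TTheory GRing.Theory Num.Theory.
Import numFieldNormedType.Exports.
Local Open Scope ring_scope.

(* The Riemann zeta function at natural numbers: the Dirichlet series
   1 + 2^-s + 3^-s + ... for s > 1, and zeta(0) = -1/2.  The value at the pole
   s = 1 is meaningless; only even arguments are used. *)
Definition zeta (R : realType) (s : nat) : R :=
  if s == 0%N then - 2^-1
  else limn (series (fun i : nat => (i.+1%:R : R) ^- s)).

(* [msize F] is one plus the total degree of F, and 0 for F = 0; hence the zero
   polynomial gets degree 0. *)
Definition mpdeg (n : nat) (F : {mpoly rat[n]}) : nat := (msize F).-1.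

(* Main.v *)
Require Import Defs.
From HB Require Import structures.
From mathcomp Require Import all_boot all_order all_algebra.
From mathcomp Require Import mpoly.
From mathcomp Require Import boolp classical_sets.
From mathcomp Require Import reals topology normedtype sequences.
From mathcomp Require Import ring lra zify.

(** Put [z k = zeta (2 k)], [G = sum_k 2 z_k t^k] and [U = 6 z_1 t], and let [D]
    be the derivation [2 t d/dt] of formal power series.  With [t = x^2] one has
    [G = - pi x cot (pi x)] and [U = (pi x)^2], so [D G = G^2 + G + U].  This
    equation amounts to [sum_(0 < j < k) z_j z_(k-j) = (k + 1/2) z_k], which is
    obtained without any trigonometry from a partial fraction decomposition of
    the partial sums of [zeta] (Williams).  It also shows by induction that
    [z_l] is a nonzero rational multiple of [z_1 ^ l].

    For a monomial [F] of exponents [a_j], the left hand side is the [k]-th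
    coefficient of the product of the series [D^(a_j) (G + 1)], up to a rational
    factor.  The series [P = G^2 + U] satisfies [D P = 2 (G + 1) P].  Modulo the
    ideal of [P] one has [D G = G], so each factor is [G] or [G + 1], and
    [G^2 = - U]: a product of [n] factors reduces to a combination of the
    [U^l G] with [2 l + 1 <= n] and of the [U^l] with [2 l <= n], the latter not
    contributing for [k >= n].  The rest is a combination of the [U^l G^j P] with
    [2 l + j + 2 <= r + n].  Solving [D (G^j P) = (j + 2) G^(j+1) P + ...] for its
    leading term turns [G^j P] into derivatives of [P = D G - G] and multiples
    by powers of [U]; the [k]-th coefficients are then of the form
    [e_l(k) z_1^l z_(k-l)]. *)

Set Implicit Arguments.
Unset Strict Implicit.
Unset Printing Implicit Defensive.

Import Order.TTheory GRing.Theory Num.Theory.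
Import numFieldNormedType.Exports.
Local Open Scope ring_scope.

(** A name of its own, so that the ring structure declared below is the Cauchy product and not the
    pointwise one. *)
Definition pser (R : comNzRingType) : Type := nat -> R.

HB.instance Definition _ (R : comNzRingType) := gen_eqMixin (pser R).
HB.instance Definition _ (R : comNzRingType) := gen_choiceMixin (pser R).

(** * Formal power series *)

Section PowerSeries.
Variable R : comNzRingType.
Implicit Types f g h : pser R.

Lemma pserP f g : (forall k, f k = g k) -> f = g.
Proof. by move=> e; apply/funext. Qed.

(** Truncation does not affect coefficients below [N], so identities on products are imported from
    [{poly R}]. *)
Definition ptrunc N f : {poly R} := \poly_(i < N) f i.

Definition padd f g : pser R := fun k => f k + g k.
Definition popp f : pser R := fun k => - f k.
Definition pcst (a : R) : pser R := fun k => if k == 0%N then a else 0.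
Definition pmul f g : pser R := fun k => \sum_(i < k.+1) f i * g (k - i)%N.

Lemma paddA : associative padd.
Proof. by move=> f g h; apply: pserP => k; exact: addrA. Qed.
Lemma paddC : commutative padd.
Proof. by move=> f g; apply: pserP => k; exact: addrC. Qed.
Lemma padd0 : left_id (fun=> 0) padd.
Proof. by move=> f; apply: pserP => k; exact: add0r. Qed.
Lemma paddN : left_inverse (fun=> 0) popp padd.
Proof. by move=> f; apply: pserP => k; exact: addNr. Qed.

HB.instance Definition _ := GRing.isZmodule.Build (pser R) paddA paddC padd0 paddN.

Lemma coef_ptrunc N f k : (k < N)%N -> (ptrunc N f)`_k = f k.
Proof. by move=> kN; rewrite coef_poly kN. Qed.

Lemma coef_ptruncM N f g k : (k < N)%N ->
  (ptrunc N f * ptrunc N g)`_k = pmul f g k.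
Proof.
move=> kN; rewrite coefM; apply: eq_bigr => -[i /= ik] _.
by rewrite !coef_ptrunc //; lia.
Qed.

Lemma pmulC : commutative pmul.
Proof.
by move=> f g; apply: pserP => k; rewrite -!(@coef_ptruncM k.+1) // mulrC.
Qed.

Lemma pmulA : associative pmul.
Proof.
move=> f g h; apply: pserP => k.
transitivity ((ptrunc k.+1 f * (ptrunc k.+1 g * ptrunc k.+1 h))`_k).
  rewrite coefM; apply: eq_bigr => -[i /= ik] _.
  by rewrite coef_ptrunc // coef_ptruncM //; lia.
rewrite mulrA coefM; apply: eq_bigr => -[i /= ik] _.
by rewrite coef_ptruncM // coef_ptrunc //; lia.
Qed.

Lemma pmulcE a f k : pmul (pcst a) f k = a * f k.
Proof.
by rewrite /pmul big_ord_recl /= subn0 big1 ?addr0 // => i _; rewrite mul0r.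
Qed.

Lemma pmul1 : left_id (pcst 1) pmul.
Proof. by move=> f; apply: pserP => k; rewrite pmulcE mul1r. Qed.

Lemma pmulDl : left_distributive pmul padd.
Proof.
move=> f g h; apply: pserP => k; rewrite /padd /pmul -big_split.
by apply: eq_bigr => i _; rewrite mulrDl.
Qed.

Lemma pcst1_neq0 : pcst 1 != 0.
Proof.
by apply/eqP => /(congr1 (@^~ 0%N)) /= /eqP; rewrite /pcst /= oner_eq0.
Qed.

HB.instance Definition _ :=
  GRing.Zmodule_isComNzRing.Build (pser R) pmulA pmulC pmul1 pmulDl pcst1_neq0.

Lemma pserDE f g k : (f + g) k = f k + g k. Proof. by []. Qed.
Lemma pserNE f k : (- f) k = - f k. Proof. by []. Qed.
Lemma pser1E k : (1 : pser R) k = (k == 0%N)%:R. Proof. by case: k. Qed.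
Lemma pserME f g k : (f * g) k = \sum_(i < k.+1) f i * g (k - i)%N.
Proof. by []. Qed.
Lemma pserCE a f k : (pcst a * f) k = a * f k. Proof. exact: pmulcE. Qed.

Lemma pserMnE f n k : (f *+ n) k = f k *+ n.
Proof. by elim: n => [//|n IH]; rewrite !mulrS pserDE IH. Qed.

Lemma pser_sumE (I : Type) (s : seq I) (P : pred I) (F : I -> pser R) k :
  (\sum_(i <- s | P i) F i) k = \sum_(i <- s | P i) F i k.
Proof. by apply: (big_morph (fun f : pser R => f k)). Qed.

Lemma coef_ptrunc_prod N (I : Type) (s : seq I) (F : I -> pser R) k :
  (k < N)%N -> (\prod_(i <- s) ptrunc N (F i))`_k = (\prod_(i <- s) F i) k.
Proof.
elim: s k => [|x s IH] k kN; first by rewrite !big_nil pser1E coef1.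
rewrite !big_cons coefM pserME; apply: eq_bigr => -[i /= ik] _.
by rewrite coef_ptrunc ?IH //; lia.
Qed.

(** Distributing the product of truncations, each choice [ks] of exponents yields a monomial whose
    degree is the sum of [ks]. *)
Lemma pser_prodE n (F : 'I_n -> pser R) k :
  (\prod_(j < n) F j) k =
  \sum_(ks : {ffun 'I_n -> 'I_k.+1} | (\sum_(j < n) (ks j : nat))%N == k)
     \prod_(j < n) F j (ks j).
Proof.
rewrite -(@coef_ptrunc_prod k.+1) //.
under eq_bigr do rewrite /ptrunc poly_def.
rewrite bigA_distr_bigA /= coef_sum [RHS]big_mkcond /=.
apply: eq_bigr => ks _.
rewrite (_ : \prod_j _ =
    (\prod_j F j (ks j)) *: 'X^(\sum_(j < n) (ks j : nat))%N); last first.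
  by rewrite scaler_prod expr_sum.
by rewrite coefZ coefXn eq_sym; case: eqP => _; rewrite ?mulr1 ?mulr0.
Qed.

Lemma pcstM a b : pcst (a * b) = pcst a * pcst b.
Proof. by apply: pserP => -[|k]; rewrite pserCE /pcst /= ?mulr0. Qed.

(* The derivation [2 t d/dt]; for an even function of [x = sqrt t] it is
   [x d/dx]. *)
Definition pder f : pser R := fun k => (2 * k)%:R * f k.

Lemma pderD f g : pder (f + g) = pder f + pder g.
Proof. by apply: pserP => k; rewrite pserDE /pder -mulrDr. Qed.

Lemma pderM f g : pder (f * g) = pder f * g + f * pder g.
Proof.
apply: pserP => k; rewrite pserDE /pder !pserME -big_split mulr_sumr.
apply: eq_bigr => -[i /= ik] _.
have {1}-> : (2 * k = 2 * i + 2 * (k - i))%N by lia.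
by rewrite natrD /=; ring.
Qed.

Lemma pder_cst a : pder (pcst a) = 0.
Proof. by apply: pserP => -[|k]; rewrite /pder ?mul0r //= mulr0. Qed.

Lemma pderX f n : pder (f ^+ n.+1) = n.+1%:R * f ^+ n * pder f.
Proof.
elim: n => [|n IH]; first by rewrite expr1 expr0 !mul1r.
by rewrite exprS pderM IH -[n.+2%:R]natr1 !exprS; ring.
Qed.

End PowerSeries.

(** * The convolution formula for even zeta values *)

Section Williams.
Variable R : realType.
Implicit Types i j d N K : nat.

Local Notation h := (series (@harmonic R)).
Local Notation psum s := (series (fun i : nat => (i.+1%:R : R) ^- s)).

Lemma harmonicS N : h N.+1 = h N + N.+1%:R^-1.
Proof. by rewrite seriesSr. Qed.

Lemma psumE s N : psum s N = \sum_(i < N) i.+1%:R ^- s.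
Proof. by rewrite /series /= big_mkord. Qed.

(* [rho i i] is [0^-1 = 0], so sums of [rho i j] over [j] skip the pole. *)
Definition rho i j : R := (j.+1%:R ^+ 2 - i.+1%:R ^+ 2)^-1.

Lemma rho_antisym i j : rho j i = - rho i j.
Proof. by rewrite /rho -invrN opprB. Qed.

(* Partial fractions:
   [2 (i+1) rho i j = 1 / (j - i) - 1 / (i + j + 2)] telescopes. *)
Lemma sum_rho_low i N : (N <= i)%N ->
  2 * i.+1%:R * (\sum_(j < N) rho i j) =
  h (i - N)%N - h i - h (N + i).+1 + h i.+1.
Proof.
elim: N => [|N IH] lNi; first by rewrite big_ord0 subn0 add0n; ring.
rewrite big_ord_recr /= mulrDr IH ?(ltnW lNi) //.
have [d ->] : exists d, i = (N + d).+1 by exists (i - N.+1)%N; lia.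
rewrite (_ : (N + d).+1 - N = d.+1)%N; last lia.
rewrite (_ : (N + d).+1 - N.+1 = d)%N; last lia.
rewrite addSn (harmonicS d) (harmonicS (N + (N + d).+1).+1).
rewrite (harmonicS (N + d).+1) /rho.
set A := h d; set B := h (N + (N + d).+1).+1; set C := h (N + d).+1.
rewrite (_ : (N + (N + d).+1).+2 = N + N + d + 3)%N; last lia.
rewrite (_ : (N + d).+2 = N + d + 2)%N; last lia.
rewrite -!(addn1 N) -(addn1 d) !natrD.
have := ler0n R N; have := ler0n R d; move: (N%:R : R) (d%:R : R) => x y y0 x0.
by field; repeat (apply/andP; split); apply/eqP; nra.
Qed.

(** For [d = 0] the pole term is zero and [sum_rho_low] applies at [N = i]; the constant
    [3 / (2 (i+1))] is [1 / (i+1) + 1 / (2i+2)], left over around the pole. *)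
Lemma sum_rho_high i d :
  2 * i.+1%:R * (\sum_(j < i.+1 + d) rho i j) =
  3 / (2 * i.+1%:R) - (h (i.+1 + d + i.+1)%N - h d).
Proof.
elim: d => [|d IH].
  rewrite addn0 big_ord_recr /= {2}/rho subrr invr0 addr0 sum_rho_low //.
  rewrite subnn (_ : i.+1 + i.+1 = (i + i).+2)%N; last lia.
  rewrite (harmonicS (i + i).+1) (harmonicS i).
  rewrite (_ : (i + i).+2 = 2 * i.+1)%N; last lia.
  rewrite natrM; have : (0 : R) < i.+1%:R by rewrite ltr0Sn.
  move: (i.+1%:R : R) => x x0.
  set A := h _; set B := h i; set C := h _.
  by field; apply/eqP; lra.
rewrite (harmonicS d) addnS big_ord_recr mulrDr IH.
rewrite (_ : (i.+1 + d).+1 + i.+1 = (i.+1 + d + i.+1).+1)%N; last lia.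
rewrite (harmonicS (i.+1 + d + i.+1)) /rho /=.
set A := h d; set B := h (_ + _ + _)%N.
rewrite (_ : (_ + _ + _).+1 = i + i + d + 3)%N; last lia.
rewrite (_ : (i.+1 + d).+1 = i + d + 2)%N; last lia.
rewrite -(addn1 i) -(addn1 d) !natrD.
have := ler0n R i; have := ler0n R d; move: (i%:R : R) (d%:R : R) => x y y0 x0.
by field; repeat (apply/andP; split); apply/eqP; nra.
Qed.

Lemma harmonic_gap d K :
  0 <= h (d + K)%N - h d <= K%:R / d.+1%:R.
Proof.
elim: K => [|K /andP[IH1 IH2]]; first by rewrite addn0 subrr mul0r lexx.
rewrite addnS harmonicS.
have t0 : (0 : R) < (d + K).+1%:R^-1 by rewrite invr_gt0 ltr0Sn.
have t1 : (d + K).+1%:R^-1 <= d.+1%:R^-1 :> R.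
  by rewrite lef_pV2 ?posrE ?ltr0Sn // ler_nat; lia.
rewrite -(addn1 K) natrD mulrDl mul1r; move: t0 t1 IH1 IH2.
move: (h _) (h _) ((d + K).+1%:R^-1 : R) (d.+1%:R^-1 : R) (_ / _) => a b x y z *.
by apply/andP; split; lra.
Qed.

(** A geometric sum in [x^-2] and [y^-2]. On the diagonal the inverse of 0 is 0, so only the second
    summand remains. *)
Lemma geometric_pairs (x y : R) K : x != 0 -> y != 0 ->
  \sum_(t < K.+1) x ^- (2 * t.+1) * y ^- (2 * (K.+1 - t)) =
  (x ^- (2 * K.+1) - y ^- (2 * K.+1)) * (y ^+ 2 - x ^+ 2)^-1
    + (if x ^+ 2 == y ^+ 2 then K.+1%:R * x ^- (2 * K.+2) else 0).
Proof.
move=> x0 y0; have := expf_neq0 2 x0; have := expf_neq0 2 y0.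
have V (z : R) m : z ^- (2 * m) = (z ^+ 2)^-1 ^+ m by rewrite exprM exprVn.
under eq_bigr do rewrite !V.
rewrite !V; move: (x ^+ 2) (y ^+ 2) => a b b0 a0.
case: eqP => [<-|/eqP ab].
  rewrite subrr mul0r add0r.
  rewrite (eq_bigr (fun=> a^-1 ^+ K.+2)) ?sumr_const ?card_ord ?mulr_natl //.
  by move=> -[t /= tK] _; rewrite -exprD; congr (_ ^+ _); lia.
rewrite addr0 subrXX.
have -> : a^-1 - b^-1 = (b - a) * (a^-1 * b^-1) by field; rewrite a0 b0.
rewrite mulrC -(mulrA (b - a)) mulKf ?subr_eq0 1?eq_sym // mulr_sumr.
rewrite (reindex_inj rev_ord_inj) /=; apply: eq_bigr => -[t /= tK] _.
rewrite (_ : (K.+1 - (K.+1 - t.+1) = t.+1)%N); last lia.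
rewrite (_ : (K.+1 - t.+1).+1 = K.+1 - t)%N; last lia.
rewrite (_ : (K.+1 - t = (K - t).+1)%N); last lia.
by rewrite !exprS; ring.
Qed.

(** Apply [geometric_pairs] to all pairs [(i+1, j+1)]: antisymmetry of [rho] makes the two
    off-diagonal halves equal, hence the factor 2. *)
Lemma psum_pairs K N :
  \sum_(t < K.+1) psum (2 * t.+1)%N N * psum (2 * (K.+1 - t))%N N =
  2 * (\sum_(i < N) i.+1%:R ^- (2 * K.+1) * \sum_(j < N) rho i j)
    + K.+1%:R * psum (2 * K.+2)%N N.
Proof.
rewrite psumE; under eq_bigr do rewrite !psumE big_distrlr /=.
rewrite exchange_big /=; under eq_bigr do rewrite exchange_big /=.
under eq_bigr => i _ do under eq_bigr => j _ do
  rewrite geometric_pairs ?pnatr_eq0 // mulrBl.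
under eq_bigr => i _ do rewrite big_split /= sumrB.
rewrite big_split /= sumrB; congr (_ + _).
  rewrite [X in _ - X]exchange_big /= -sumrB mulr_sumr; apply: eq_bigr => i _.
  rewrite -sumrB !mulr_sumr; apply: eq_bigr => j _.
  by have := rho_antisym i j; rewrite /rho => ->; ring.
rewrite mulr_sumr; apply: eq_bigr => i _.
rewrite (bigD1 i) //= eqxx big1 ?addr0 // => j ji.
by rewrite eqrXn2 ?ler0n // eqr_nat eqSS eq_sym val_eqE (negPf ji).
Qed.

Definition perr K N : R :=
  \sum_(i < N) i.+1%:R ^- (2 * K.+1) * i.+1%:R^-1
    * (h (N + i.+1)%N - h (N - i.+1)%N).

(** The coefficient is [K+1] from the diagonal plus [3/2] from [sum_rho_high]; [perr] collects the
    harmonic gaps occurring there. *)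
Lemma psum_pairsE K N :
  \sum_(t < K.+1) psum (2 * t.+1)%N N * psum (2 * (K.+1 - t))%N N =
  (K.+2%:R + 2^-1) * psum (2 * K.+2)%N N - perr K N.
Proof.
rewrite psum_pairs mulr_sumr /perr !psumE !mulr_sumr.
rewrite -sumrB -big_split /=; apply: eq_bigr => -[i /= iN] _.
have [d ->] : exists d, N = (i.+1 + d)%N by exists (N - i.+1)%N; lia.
rewrite (_ : 2 * K.+2 = 2 * K.+1 + 2)%N; last lia.
rewrite exprD invfM -[K.+2%:R]natr1.
have := sum_rho_high i d; rewrite addKn; move: (h _) (h _) => A B.
have : (0 : R) < i.+1%:R by rewrite ltr0Sn.
move: (\sum_(_ < _) _) (K.+1%:R : R) => s k.
move: (i.+1%:R ^- (2 * K.+1) : R) => v; move: (i.+1%:R : R) => x x0 E.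
have -> : s = 2 * x * s / (2 * x) by field; apply/eqP; lra.
by rewrite E; field; apply/eqP; lra.
Qed.

(** * Error estimate and passage to the limit *)

Lemma psum2_le N : psum 2 N <= 2.
Proof.
case: N => [|N]; first by rewrite psumE big_ord0.
suff: psum 2 N.+1 <= 2 - N.+1%:R^-1.
  by move=> H; apply: le_trans H _; rewrite gerBl invr_ge0.
elim: N => [|N IH]; first by rewrite psumE big_ord1 expr1n invr1; lra.
rewrite seriesSr; apply: le_trans (lerD IH (lexx _)) _.
rewrite -[N.+2%:R]natr1; have : (0 : R) < N.+1%:R by rewrite ltr0Sn.
move: (N.+1%:R : R) => x x0.
rewrite -subr_ge0 (_ : _ - _ = (x * (x + 1) ^+ 2)^-1); last first.
  by field; apply/andP; split; apply/eqP; lra.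
by rewrite invr_ge0; nra.
Qed.

Lemma perr_ge0 K N : 0 <= perr K N.
Proof.
apply: sumr_ge0 => -[i /= iN] _; rewrite !mulr_ge0 ?invr_ge0 ?exprn_ge0 //.
have := harmonic_gap (N - i.+1) (i.+1 + i.+1).
by rewrite (_ : (N - i.+1 + (i.+1 + i.+1) = N + i.+1)%N); [case/andP|lia].
Qed.

(** Let [x = i+1] and [N = x + y]. The gap consists of [2x] terms, each at most [1/(y+1)], and
    [1/(x^2 (y+1)) = (1/x^2 + 1/(x (y+1))) / (N+1)] with [x (y+1) >= N]. Summing over [i] gives
    [6 = 2 (2 + 1)]. *)
Lemma perr_le K N : perr K N <= 6 * harmonic N.
Proof.
have key i : (i < N)%N ->
    i.+1%:R ^- (2 * K.+1) * i.+1%:R^-1 * (h (N + i.+1)%N - h (N - i.+1)%N) <=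
    2 * N.+1%:R^-1 * (i.+1%:R ^- 2 + N%:R^-1).
  move=> iN; have := harmonic_gap (N - i.+1) (i.+1 + i.+1).
  rewrite (_ : (N - i.+1 + (i.+1 + i.+1) = N + i.+1)%N); last lia.
  case/andP=> A0 A1; set A := _ - _ in A0 A1 *.
  have : i.+1%:R ^- (2 * K.+1) <= i.+1%:R ^- 2 :> R.
    rewrite lef_pV2 ?posrE ?exprn_gt0 ?ltr0Sn // ler_weXn2l ?ler1n //; lia.
  have : (0 : R) <= i.+1%:R ^- (2 * K.+1) by rewrite invr_ge0 exprn_ge0.
  move: (_ ^- (2 * K.+1)) => v v0 v1.
  have [d E] : exists d, N = (i.+1 + d)%N by exists (N - i.+1)%N; lia.
  move: A1; rewrite E addKn -[(i.+1 + d).+1]addnS !natrD -[d.+1%:R]natr1.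
  have : (1 : R) <= i.+1%:R by rewrite ler1n.
  have := ler0n R d.
  move: (i.+1%:R : R) (d%:R : R) v1 => x y v1 y0 x1 A1.
  apply: (@le_trans _ _ (x ^- 2 * x^-1 * ((x + x) / (y + 1)))).
    rewrite -mulrA -[leRHS]mulrA ler_pM ?mulr_ge0 ?invr_ge0 //; first lra.
    by rewrite ler_wpM2l // invr_ge0; lra.
  rewrite -subr_ge0 (_ : _ - _ =
      2 / (x + (y + 1)) * (y * (x - 1) / (x * (x + y) * (y + 1)))).
    by rewrite !mulr_ge0 ?invr_ge0 ?mulr_ge0 //; lra.
  by field; repeat (apply/andP; split); apply/eqP; lra.
apply: (@le_trans _ _ (\sum_(i < N) 2 * N.+1%:R^-1 * (i.+1%:R ^- 2 + N%:R^-1))).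
  by apply: ler_sum => i _; exact: key.
rewrite -mulr_sumr big_split /= sumr_const card_ord /harmonic /=.
have -> : (6 * N.+1%:R^-1 : R) = 2 * N.+1%:R^-1 * 3 by ring.
rewrite ler_wpM2l ?mulr_ge0 ?invr_ge0 //.
have := psum2_le N; rewrite psumE => H.
suff : N%:R^-1 *+ N <= 1 :> R by lra.
case: N {key H} => [|N]; first by rewrite mulr0n ler01.
by rewrite -(mulr_natr _^-1) mulVf // pnatr_eq0.
Qed.

Local Open Scope classical_set_scope.

Lemma psum_cvg s : (1 < s)%N -> psum s @ \oo --> zeta R s.
Proof.
move=> s1; rewrite /zeta; case: eqP => [s0|_]; first by rewrite s0 in s1.
apply: nondecreasing_is_cvgn.
  by apply: nondecreasing_series => i _ _; rewrite invr_ge0 exprn_ge0.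
exists 2 => _ [N _ <-]; apply: le_trans (psum2_le N).
rewrite /series /=; apply: ler_sum => i _.
by rewrite lef_pV2 ?posrE ?exprn_gt0 ?ltr0Sn // ler_weXn2l ?ler1n.
Qed.

Lemma perr_cvg K : perr K @ \oo --> (0 : R).
Proof.
have H : (fun N => 6 * @harmonic R N) @ \oo --> (0 : R).
  by rewrite -[X in _ --> X](mulr0 6); apply: cvgM;
    [exact: cvg_cst|exact: cvg_harmonic].
apply: (squeeze_cvgr _ (cvg_cst 0) H).
by apply: nearW => N; rewrite perr_ge0 perr_le.
Qed.

Lemma cvg_sumr (I : Type) (s : seq I) (f : I -> nat -> R) (l : I -> R) :
  (forall t, f t @ \oo --> l t) ->
  (fun N => \sum_(t <- s) f t N) @ \oo --> \sum_(t <- s) l t.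
Proof.
move=> fl; elim: s => [|t s IH].
  by rewrite big_nil; under eq_fun do rewrite big_nil; exact: cvg_cst.
rewrite big_cons; under eq_fun do rewrite big_cons.
by apply: cvgD; [exact: fl|exact: IH].
Qed.

Lemma zeta_even_convolution K :
  \sum_(t < K.+1) zeta R (2 * t.+1) * zeta R (2 * (K.+1 - t)) =
  (K.+2%:R + 2^-1) * zeta R (2 * K.+2).
Proof.
have Hl : (fun N => \sum_(t < K.+1) psum (2 * t.+1)%N N * psum (2 * (K.+1 - t))%N N)
    @ \oo --> \sum_(t < K.+1) zeta R (2 * t.+1) * zeta R (2 * (K.+1 - t)).
  by apply: cvg_sumr => t; apply: cvgM; apply: psum_cvg; have := ltn_ord t; lia.
have Hr : (fun N => (K.+2%:R + 2^-1) * psum (2 * K.+2)%N N - perr K N)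
    @ \oo --> (K.+2%:R + 2^-1) * zeta R (2 * K.+2).
  rewrite -[X in _ --> X]subr0; apply: cvgB; last exact: perr_cvg.
  by apply: cvgM; [exact: cvg_cst|apply: psum_cvg; lia].
rewrite (_ : (fun N => _) =
    (fun N => (K.+2%:R + 2^-1) * psum (2 * K.+2)%N N - perr K N)) in Hl.
  exact: (cvg_unique _ Hl Hr).
by apply/funext => N; exact: psum_pairsE.
Qed.

End Williams.

(** * The differential ring generated by the zeta series *)

Section ZetaSeries.
Variable R : realType.
Implicit Types (f g : pser R) (e : nat -> {poly rat}) (q : rat).

Local Notation z k := (zeta R (2 * k)).

Definition Gser : pser R := fun k => 2 * z k.
Definition ucoef : R := 6 * z 1.
Definition User : pser R := fun k => if k == 1%N then ucoef else 0.
Definition Pser : pser R := Gser ^+ 2 + User.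
Definition qcst q : pser R := pcst (ratr q).

Local Notation G := Gser.
Local Notation U := User.
Local Notation P := Pser.

Lemma zeta0 : z 0 = - 2^-1. Proof. by rewrite /zeta muln0. Qed.

Lemma UserM f k : (U * f) k = if k is k'.+1 then ucoef * f k' else 0.
Proof.
case: k => [|k]; first by rewrite pserME big_ord1 mul0r.
rewrite pserME big_ord_recl mul0r add0r big_ord_recl /= subSS subn0.
by rewrite big1 ?addr0 // => i _; rewrite mul0r.
Qed.

Lemma UserXM l f k :
  (U ^+ l * f) k = if (l <= k)%N then ucoef ^+ l * f (k - l)%N else 0.
Proof.
elim: l k => [|l IH] k; first by rewrite !mul1r subn0.
rewrite exprS -mulrA UserM; case: k => [|k] //.
by rewrite IH ltnS subSS exprS; case: ifP => _; rewrite ?mulr0 // mulrA.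
Qed.

(** Coefficient 0 rests on [zeta 0 = -1/2], coefficient 1 on the value of [ucoef]; the others are
    [zeta_even_convolution] once the two end terms of [G ^+ 2] are split off. *)
Lemma pder_Gser : pder G = G ^+ 2 + G + U.
Proof.
apply: pserP => -[|[|K]]; rewrite !pserDE expr2 pserME /pder /Gser /User /=.
- by rewrite big_ord1 zeta0; field.
- by rewrite !big_ord_recl big_ord0 /= zeta0 /ucoef muln1; field.
rewrite big_ord_recl big_ord_recr /= zeta0 subn0 subnn zeta0.
have := zeta_even_convolution R K.
under [in X in _ -> X]eq_bigr => i _ do rewrite mulrACA /bump /= add1n subSS.
rewrite -mulr_sumr => ->; rewrite natrM; set x := zeta _ _.
by field.
Qed.

Lemma pder_User : pder U = 2 * U.
Proof.
apply: pserP => k; rewrite mulr_natl pserMnE /pder /User.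
by case: eqP => [->|_]; rewrite ?mulr0 ?mul0rn // mulr_natl.
Qed.

Lemma pder_Pser : pder P = 2 * (G + 1) * P.
Proof. by rewrite {1}/Pser pderD pderX pder_Gser pder_User /Pser; ring. Qed.

Lemma pder_UserX l : pder (U ^+ l) = (2 * l)%:R * U ^+ l.
Proof.
case: l => [|l]; first by rewrite muln0 mul0r; exact: pder_cst.
by rewrite pderX pder_User natrM exprS; ring.
Qed.

(** The coefficient [j + 2] of the top term, [j] from [G ^+ j] and 2 from [P], never vanishes, so
    that term can be solved for. At [j = 0] the factor [j%:R] cancels the term with the meaningless
    [j.-1]. *)
Lemma pder_monomial l j : pder (U ^+ l * G ^+ j * P) =
  (2 * l + j + 2)%:R * (U ^+ l * G ^+ j * P) + j.+2%:R * (U ^+ l * G ^+ j.+1 * P)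
  + j%:R * (U ^+ l.+1 * G ^+ j.-1 * P).
Proof.
rewrite !pderM pder_UserX pder_Pser; case: j => [|j].
  by rewrite expr0 (pder_cst 1); rewrite addn0 natrD expr1; ring.
rewrite pderX pder_Gser /= -[j.+3%:R]natr1 -[j.+2%:R]natr1 !natrD !exprS.
by ring.
Qed.

(** * Rational constants and the weight filtration on the ideal of [P] *)

Lemma qcst_nat n : qcst n%:R = n%:R.
Proof.
apply: pserP => k; rewrite /qcst ratr_nat /pcst.
by rewrite pserMnE pser1E; case: k => //= k; rewrite mul0rn.
Qed.

Lemma qcstM q1 q2 : qcst (q1 * q2) = qcst q1 * qcst q2.
Proof. by rewrite /qcst rmorphM pcstM. Qed.

Lemma qcstN q : qcst (- q) = - qcst q.
Proof.
by apply: pserP => -[|k]; rewrite pserNE /qcst /pcst /= ?rmorphN ?oppr0.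
Qed.

Lemma pder_qcstM q f : pder (qcst q * f) = qcst q * pder f.
Proof. by rewrite pderM pder_cst mul0r add0r. Qed.

(* [G] and [P] have weights 1 and 2 and [U] has weight 2; [idl w] is the part of
   weight at most [w] of the differential ideal generated by [P]. *)
Inductive idl (w : nat) : pser R -> Prop :=
| idl_0 : idl w 0
| idl_mon q l j : (2 * l + j + 2 <= w)%N -> idl w (qcst q * (U ^+ l * G ^+ j * P))
| idl_add f g : idl w f -> idl w g -> idl w (f + g).

Lemma idl_leq w v f : (w <= v)%N -> idl w f -> idl v f.
Proof.
move=> wv; elim=> [|q l j h|f1 f2 _ h1 _ h2]; first exact: idl_0.
  by apply: idl_mon; lia.
exact: idl_add.
Qed.

Lemma idl_qcst w q f : idl w f -> idl w (qcst q * f).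
Proof.
elim=> [|q' l j h|f1 f2 _ h1 _ h2]; first by rewrite mulr0; exact: idl_0.
  by rewrite mulrA -qcstM; exact: idl_mon.
by rewrite mulrDr; exact: idl_add.
Qed.

Lemma idl_nat w n f : idl w f -> idl w (n%:R * f).
Proof. by rewrite -qcst_nat; exact: idl_qcst. Qed.

Lemma idl_monomial w l j : (2 * l + j + 2 <= w)%N -> idl w (U ^+ l * G ^+ j * P).
Proof.
by move=> h; rewrite -[X in idl _ X]mul1r -[1](qcst_nat 1); exact: idl_mon.
Qed.

Lemma idl_mulG w f : idl w f -> idl w.+1 (G * f).
Proof.
elim=> [|q l j h|f1 f2 _ h1 _ h2]; first by rewrite mulr0; exact: idl_0.
  rewrite (_ : _ * _ = qcst q * (U ^+ l * G ^+ j.+1 * P)).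
    by apply: idl_mon; lia.
  by rewrite exprS; ring.
by rewrite mulrDr; exact: idl_add.
Qed.

Lemma idl_mulU w f : idl w f -> idl w.+2 (U * f).
Proof.
elim=> [|q l j h|f1 f2 _ h1 _ h2]; first by rewrite mulr0; exact: idl_0.
  rewrite (_ : _ * _ = qcst q * (U ^+ l.+1 * G ^+ j * P)).
    by apply: idl_mon; lia.
  by rewrite exprS; ring.
by rewrite mulrDr; exact: idl_add.
Qed.

Lemma idl_mulGX w j f : idl w f -> idl (w + j) (G ^+ j * f).
Proof.
move=> h; elim: j => [|j IH]; first by rewrite addn0 mul1r.
by rewrite addnS exprS -mulrA; exact: idl_mulG.
Qed.

Lemma idl_mulUX w l f : idl w f -> idl (w + 2 * l) (U ^+ l * f).
Proof.
move=> h; elim: l => [|l IH]; first by rewrite muln0 addn0 mul1r.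
by rewrite mulnS addnCA exprS -mulrA; exact: idl_mulU.
Qed.

(** Multiplying by [P = G ^+ 2 + U] raises the weight by 2, so each monomial of [g] raises it by its
    own weight. *)
Lemma idl_mul w v f g : idl w f -> idl v g -> idl (w + v) (f * g).
Proof.
move=> hf; elim=> [|q l j h|g1 g2 _ h1 _ h2]; first by rewrite mulr0; exact: idl_0.
  have hP : idl (w + 2) (P * f).
    rewrite /Pser mulrDl addn2; apply: idl_add; last exact: idl_mulU.
    by rewrite expr2 -mulrA; do 2![apply: idl_mulG].
  rewrite (_ : _ * _ = qcst q * (U ^+ l * (G ^+ j * (P * f)))); last by ring.
  apply/idl_qcst/(@idl_leq (w + 2 + j + 2 * l)); first lia.
  exact/idl_mulUX/idl_mulGX.
by rewrite mulrDr; exact: idl_add.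
Qed.

Lemma idl_pder w f : idl w f -> idl w.+1 (pder f).
Proof.
elim=> [|q l j h|f1 f2 _ h1 _ h2].
- rewrite (_ : pder 0 = 0); first exact: idl_0.
  by apply: pserP => k; rewrite /pder mulr0.
- rewrite pder_qcstM pder_monomial; apply/idl_qcst/idl_add; first apply/idl_add.
  + by apply/idl_nat/idl_monomial; lia.
  + by apply/idl_nat/idl_monomial; lia.
  + case: j h => [|j] h; first by rewrite mul0r; exact: idl_0.
    by apply/idl_nat/idl_monomial; lia.
- by rewrite pderD; exact: idl_add.
Qed.

Lemma idl_P : idl 2 P.
Proof. by rewrite -[P]mul1r -[1]mul1r; exact: (@idl_monomial 2 0 0). Qed.

(** * Reduction of products of derivatives modulo [P] *)

(** [D G = G + P], so [G] is fixed modulo the ideal, while the constant 1 dies at the first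
    derivative. *)
Lemma iter_pder_Gser a :
  exists2 J, idl a.+1 J & iter a (@pder R) (G + 1) = (a == 0)%:R + G + J.
Proof.
elim: a => [|a [J hJ E]]; first by exists 0; [exact: idl_0|rewrite addr0 addrC].
exists (P + pder J).
  by apply: idl_add; [apply: idl_leq idl_P|exact: idl_pder].
rewrite iterS E !pderD pder_Gser -qcst_nat pder_cst add0r add0r /Pser; ring.
Qed.

(* The elements of weight at most [w] whose residue modulo [P] has weight at most
   [n]. *)
Inductive red (n w : nat) : pser R -> Prop :=
| red_idl f : idl w f -> red n w f
| red_G q l : (2 * l + 1 <= n)%N -> red n w (qcst q * (U ^+ l * G))
| red_U q l : (2 * l <= n)%N -> red n w (qcst q * U ^+ l)
| red_add f g : red n w f -> red n w g -> red n w (f + g).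

Lemma red_leq n w m v f : (n <= m)%N -> (w <= v)%N -> red n w f -> red m v f.
Proof.
move=> nm wv; elim=> [f' h|q l h|q l h|f1 f2 _ h1 _ h2].
- exact/red_idl/(idl_leq wv).
- by apply: red_G; lia.
- by apply: red_U; lia.
- exact: red_add.
Qed.

Lemma red_qcst n w q f : red n w f -> red n w (qcst q * f).
Proof.
elim=> [f' h|q' l h|q' l h|f1 f2 _ h1 _ h2].
- exact/red_idl/idl_qcst.
- by rewrite mulrA -qcstM; exact: red_G.
- by rewrite mulrA -qcstM; exact: red_U.
- by rewrite mulrDr; exact: red_add.
Qed.

(** The factor is a constant plus [G] plus [J]. Only [G] acts on the residue in a new way, through
    [G ^+ 2 = P - U]; products with [J] fall in the ideal, and [n <= w] bounds their weight. *)
Lemma red_mul n w a f : (n <= w)%N -> red n w f ->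
  red n.+1 (w + a.+1) (f * iter a (@pder R) (G + 1)).
Proof.
move=> nw; have [J hJ ->] := iter_pder_Gser a; rewrite -qcst_nat => hf.
rewrite 2!mulrDr; apply: red_add; first apply: red_add.
- by rewrite mulrC; apply/red_qcst; apply: red_leq hf; lia.
- elim: hf => [f' h|q l h|q l h|f1 f2 _ h1 _ h2].
  + apply: red_idl; rewrite mulrC; apply: (@idl_leq w.+1); first lia.
    exact: idl_mulG.
  + rewrite (_ : _ * _ = qcst q * (U ^+ l * G ^+ 0 * P) + qcst (- q) * U ^+ l.+1).
      by apply: red_add; [apply/red_idl/idl_mon; lia|apply: red_U; lia].
    by rewrite qcstN /Pser (exprS U l); ring.
  + by rewrite -mulrA; apply: red_G; lia.
  + by rewrite mulrDl; exact: red_add.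
- apply: red_idl; elim: hf => [f' h|q l h|q l h|f1 f2 _ h1 _ h2].
  + exact: idl_mul.
  + rewrite -2!mulrA; apply: idl_qcst; apply: (@idl_leq (a.+2 + 2 * l)); first lia.
    exact/idl_mulUX/idl_mulG.
  + rewrite -mulrA; apply: idl_qcst; apply: (@idl_leq (a.+1 + 2 * l)); first lia.
    exact: idl_mulUX.
  + by rewrite mulrDl; exact: idl_add.
Qed.

Lemma red_prod (I : Type) (s : seq I) (a : I -> nat) :
  red (size s) (\sum_(i <- s) (a i).+1)
    (\prod_(i <- s) iter (a i) (@pder R) (G + 1)).
Proof.
elim: s => [|i s IH].
  rewrite !big_nil -[X in red _ _ X]mulr1 -[X in X * _](qcst_nat 1).
  exact: (@red_U 0 0 _ 0).
rewrite !big_cons mulrC addnC /=; apply: red_mul => //.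
by rewrite -sum1_size leq_sum.
Qed.

(** * Coefficients as polynomial combinations of zeta values *)

(** In the second clause the first alternative comes from the ideal and the second from the residue;
    for [w = r + n] they are the two entries of the maximum [T]. Powers of [ucoef] stand in for
    [z l], so that multiplying by [U] is a shift of [l]. *)
Definition zform (n w : nat) (f : pser R) := exists e, [/\
  forall l, (size (e l) <= w - 2 * l)%N,
  forall l, e l != 0 -> (2 * l + 2 <= w)%N || (2 * l + 1 <= n)%N &
  forall k, (n <= k)%N ->
    f k = \sum_(l < k.+1) ratr (e l).[k%:R] * ucoef ^+ l * z (k - l)].

Lemma zform_vanish n w f : (forall k, (n <= k)%N -> f k = 0) -> zform n w f.
Proof.
move=> f0; exists (fun=> 0); split=> [l|l|k nk]; rewrite ?size_poly0 ?eqxx //.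
by rewrite f0 // big1 // => i _; rewrite horner0 rmorph0 !mul0r.
Qed.

Lemma zform_add n w f g : zform n w f -> zform n w g -> zform n w (f + g).
Proof.
move=> [e [s0 v0 E0]] [e' [s1 v1 E1]]; exists (fun l => e l + e' l).
split=> [l|l|k nk].
- by rewrite (leq_trans (size_polyD _ _)) // geq_max s0 s1.
- have := v0 l; have := v1 l; case: (eqVneq (e l) 0) => [->|_ _ /(_ isT)//].
  by rewrite add0r => h _; exact: h.
- rewrite pserDE E0 // E1 // -big_split; apply: eq_bigr => i _ /=.
  by rewrite hornerD rmorphD /= !mulrDl.
Qed.

Lemma zform_qcst n w q f : zform n w f -> zform n w (qcst q * f).
Proof.
move=> [e [s v E]]; exists (fun l => q *: e l); split=> [l|l|k nk].
- exact: leq_trans (size_scale_leq _ _) (s l).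
- by rewrite scaler_eq0 negb_or => /andP[_ /v].
- rewrite pserCE E // mulr_sumr; apply: eq_bigr => i _.
  by rewrite hornerZ rmorphM /= !mulrA.
Qed.

Lemma zform_leq n w m v f : (n <= m)%N -> (w <= v)%N -> zform n w f -> zform m v f.
Proof.
move=> nm wv [e [s h E]]; exists e; split=> [l|l /h|k mk].
- by apply: leq_trans (s l) _; lia.
- lia.
- by apply: E; lia.
Qed.

Lemma zform_pder w f : zform 0 w f -> zform 0 w.+1 (pder f).
Proof.
move=> [e [s v E]]; exists (fun l => (2 *: 'X) * e l); split=> [l|l|k _].
- case: (eqVneq (e l) 0) => [->|nz]; first by rewrite mulr0 size_poly0.
  (* A nonzero [e l] forces [2 l + 2 <= w], so the subtraction [w - 2 l] is a true one and grows by
     one with [w]. *)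
  have := v l nz; have := s l; rewrite -scalerAl => h1 h2.
  apply: leq_trans (size_scale_leq _ _) _.
  by rewrite mulrC size_mulX //; lia.
- by rewrite mulf_eq0 negb_or => /andP[_ /v]; lia.
- rewrite /pder E // mulr_sumr; apply: eq_bigr => i _.
  by rewrite hornerM hornerZ hornerX rmorphM -natrM /= ratr_nat !mulrA.
Qed.

Lemma zform_mulU w f : zform 0 w f -> zform 0 w.+2 (U * f).
Proof.
move=> [e [s v E]].
have sX : size ('X - 1%:P : {poly rat}) = 2 by rewrite size_XsubC.
(* The [k]-th coefficient of [U * f] is [ucoef] times the previous one of [f], hence the
   substitution of [X - 1]. *)
exists (fun l => if l is l'.+1 then e l' \Po ('X - 1%:P) else 0).
split=> [[|l]|[|l]|[|k] _]; rewrite ?size_poly0 ?eqxx //.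
- by rewrite size_comp_poly2 //; apply: leq_trans (s l) _; lia.
- by rewrite -size_poly_eq0 size_comp_poly2 // size_poly_eq0 => /v; lia.
- by rewrite UserM big_ord1 horner0 rmorph0 !mul0r.
rewrite UserM E // [RHS]big_ord_recl /= horner0 rmorph0 !mul0r add0r mulr_sumr.
apply: eq_bigr => i _; rewrite /bump /= add1n subSS horner_comp hornerXsubC.
by rewrite -natr1 addrK exprS; ring.
Qed.

(** Since [P = D G - G], its [k]-th coefficient is [(2k - 1) 2 z_k]. *)
Lemma zform_P : zform 0 2 P.
Proof.
exists (fun l => if l == 0 then 4 *: 'X - 2%:P else 0).
split=> [[|l]|[|l]|k _] //=; rewrite ?size_poly0 ?eqxx //.
  rewrite (leq_trans (size_polyD _ _)) // geq_max size_polyN size_polyC.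
  by rewrite (leq_trans (size_scale_leq _ _)) ?size_polyX //; case: eqP.
have -> : P = pder G - G by rewrite pder_Gser /Pser; ring.
rewrite big_ord_recl big1 => [|i _]; last by rewrite horner0 rmorph0 !mul0r.
rewrite /= hornerD hornerN hornerZ hornerX hornerC subn0 addr0 pserDE pserNE.
by rewrite /pder /Gser rmorphB rmorphM /= !ratr_nat natrM; ring.
Qed.

(* Solving [pder_monomial] at [l = 0] for its leading term [G ^+ j.+1 * P]. *)
Lemma zform_GP j : zform 0 (j + 2) (G ^+ j * P).
Proof.
have [m] := ubnP j; elim: m j => // m IH [|j] jm.
  by rewrite mul1r; exact: zform_P.
have -> : G ^+ j.+1 * P = qcst j.+2%:R^-1 * (pder (G ^+ j * P)
   + (qcst (- j.+2%:R) * (G ^+ j * P) + qcst (- j%:R) * (U * (G ^+ j.-1 * P)))).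
  have := pder_monomial 0 j; rewrite !expr0 expr1 !mul1r add0n addn2 => ->.
  apply: pserP => k; rewrite !(pserCE, pserDE) -!qcst_nat !pserCE.
  rewrite mulrA !(rmorphN, fmorphV, ratr_nat) /=.
  by field; rewrite -natrD pnatr_eq0.
apply: zform_qcst; apply: zform_add; first exact/zform_pder/IH.
apply: zform_add.
  by apply: zform_qcst; apply: zform_leq (IH j _) => //; lia.
case: j jm => [|j] jm.
  by apply: zform_vanish => k _; rewrite pserCE oppr0 rmorph0 mul0r.
by apply/zform_qcst; apply: zform_leq (zform_mulU (IH j _)) => //; lia.
Qed.

Lemma idl_zform w f : idl w f -> zform 0 w f.
Proof.
elim=> [|q l j h|f1 f2 _ h1 _ h2].
- exact: zform_vanish.
- apply/zform_qcst/(zform_leq (leqnn _) h); rewrite -mulrA -addnA.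
  elim: l {h} => [|l IH]; first by rewrite mul1r; exact: zform_GP.
  by rewrite exprS -mulrA mulnS -addnA; exact: zform_mulU.
- exact: zform_add.
Qed.

(** [U ^+ l * G] has coefficients [2 ucoef^l z_(k-l)]. [U ^+ l] lives in degree [l] alone, and
    [2 l <= n] with [n > 0] gives [l < n <= k]. *)
Lemma red_zform n w f : (0 < n <= w)%N -> red n w f -> zform n w f.
Proof.
move=> /andP[n0 nw]; elim=> [f' h|q l h|q l h|f1 f2 _ h1 _ h2].
- by apply: zform_leq (idl_zform h).
- apply: zform_qcst; exists (fun i => if i == l then 2%:P else 0).
  split=> [i|i|k nk].
  + case: eqP => [->|]; rewrite ?size_poly0 ?size_polyC //=; lia.
  + by case: (eqVneq i l) => [-> _|_]; [rewrite h orbT|rewrite eqxx].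
  + have lk : (l < k.+1)%N by lia.
    rewrite (bigD1 (Ordinal lk)) //= eqxx big1 => [|i il]; last first.
      rewrite ifF ?horner0 ?rmorph0 ?mul0r //.
      by apply: contraNF il => /eqP il; apply/eqP/val_inj.
    by rewrite UserXM -ltnS lk hornerC ratr_nat /Gser; ring.
- apply/zform_qcst/zform_vanish => k nk.
  rewrite -[U ^+ l]mulr1 UserXM pser1E; case: ifP => // lk.
  by rewrite (_ : (k - l == 0)%N = false) ?mulr0 //; lia.
- exact: zform_add.
Qed.

(** * Generating series of the left-hand side *)

(** Coefficient 0 is set to zero to enforce [k_j >= 1]; this matches the 1 in [G + 1], which cancels
    [2 z_0 = -1]. *)
Definition Hser (a : nat) : pser R :=
  fun k => if k == 0%N then 0 else k%:R ^+ a * z k.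

Lemma HserE a : Hser a = qcst (2 ^- a.+1) * iter a (@pder R) (G + 1).
Proof.
have iterE k : iter a (@pder R) (G + 1) k = (2 * k)%:R ^+ a * (G + 1) k.
  elim: a => [|a IH]; first by rewrite mul1r.
  by rewrite iterS /pder IH exprS mulrA.
apply: pserP => k; rewrite pserCE iterE pserDE pser1E /Hser /Gser.
case: eqP => [->|/eqP k0].
  by rewrite zeta0 mulrN divff ?addNr ?mulr0 ?pnatr_eq0.
rewrite addr0 natrM exprMn fmorphV rmorphXn /= ratr_nat exprS.
have : (2 : R) ^+ a != 0 by rewrite expf_neq0 ?pnatr_eq0.
by move=> ?; field.
Qed.

Lemma zform_prod_Hser n (a : 'I_n -> nat) : (0 < n)%N ->
  zform n (\sum_(j < n) a j + n) (\prod_(j < n) Hser (a j)).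
Proof.
move=> n0; rewrite (eq_bigr _ (fun j _ => HserE (a j))) big_split /=.
have -> : \prod_(j < n) qcst (2 ^- (a j).+1) = qcst (\prod_(j < n) 2 ^- (a j).+1).
  by apply/esym/(big_morph qcst qcstM (qcst_nat 1)).
apply/zform_qcst/red_zform; first lia.
have := red_prod (index_enum 'I_n) a.
rewrite (_ : size (index_enum 'I_n) = n); last first.
  by rewrite -[RHS]size_enum_ord enumT.
rewrite (_ : \sum_(i < n) (a i).+1 = \sum_(i < n) a i + n)%N //.
under eq_bigr do rewrite -addn1.
by rewrite big_split /= sum_nat_const card_ord muln1.
Qed.

(** * Trading powers of [ucoef] for zeta values *)

(** Strong induction through [zeta_even_convolution]. Positivity passes through the sum and makes
    [q] invertible in [ucoefX_rational]. *)
Lemma zeta_even_rational l :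
  (0 < l)%N -> exists2 q : rat, 0 < q & z l = ratr q * ucoef ^+ l.
Proof.
have sumP (c : R) m (F : 'I_m.+1 -> R) :
    (forall i, exists2 q : rat, 0 < q & F i = ratr q * c) ->
    exists2 q : rat, 0 < q & \sum_(i < m.+1) F i = ratr q * c.
  elim: m F => [|m IH] F hF; first by rewrite big_ord1; exact: hF.
  rewrite big_ord_recr; have [q q0 ->] := hF ord_max.
  have [q' q'0 ->] := IH _ (fun i => hF (widen_ord (leqnSn _) i)).
  by exists (q' + q); rewrite ?addr_gt0 //= rmorphD mulrDl.
have [m] := ubnP l; elim: m l => // m IH [|[|K]] // lm _.
  exists 6^-1 => //; rewrite expr1 /ucoef fmorphV /= ratr_nat; set x := zeta _ _.
  by field.
have [|q q0 E] := @sumP (ucoef ^+ K.+2) K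
    (fun t => z t.+1 * z (K.+1 - t)).
  move=> [t /= tK].
  have [||q q0 ->] := IH t.+1; [lia|by []|].
  have [||q' q'0 ->] := IH (K.+1 - t)%N; [lia|by rewrite subn_gt0|].
  exists (q * q'); first exact: mulr_gt0.
  rewrite rmorphM /= mulrACA -exprD; congr (_ * _ ^+ _); lia.
exists ((K.+2%:R + 2^-1)^-1 * q).
  by rewrite mulr_gt0 // invr_gt0 addr_gt0.
rewrite rmorphM /= -mulrA -E zeta_even_convolution fmorphV rmorphD fmorphV /=.
by rewrite !ratr_nat mulKf // lt0r_neq0 // addr_gt0 ?ltr0Sn ?invr_gt0.
Qed.

Lemma ucoefX_rational : exists rho : nat -> rat,
  forall l, ucoef ^+ l = ratr (rho l) * z l.
Proof.
suff H l : exists q, ucoef ^+ l = ratr q * z l.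
  by have [rho rhoE] := choice H; exists rho.
case: l => [|l].
  by exists (- 2); rewrite zeta0 rmorphN /= ratr_nat; field.
have [//|q q0 ->] := @zeta_even_rational l.+1.
exists q^-1; rewrite mulrA fmorphV mulVf ?mul1r //.
by rewrite fmorph_eq0 lt0r_neq0.
Qed.

Lemma zform_zeta n w f : zform n w f -> exists e, [/\
  forall l, (size (e l) <= w - 2 * l)%N,
  forall l, e l != 0 -> (2 * l + 2 <= w)%N || (2 * l + 1 <= n)%N &
  forall k, (n <= k)%N ->
    f k = \sum_(l < k.+1) ratr (e l).[k%:R] * z l * zeta R (2 * k - 2 * l)].
Proof.
have [rho rhoE] := ucoefX_rational => -[e [s v E]].
exists (fun l => rho l *: e l); split=> [l|l|k nk].
- exact: leq_trans (size_scale_leq _ _) (s l).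
- by rewrite scaler_eq0 negb_or => /andP[_ /v].
- rewrite E //; apply: eq_bigr => i _.
  by rewrite rhoE hornerZ rmorphM -mulnBr /=; ring.
Qed.

End ZetaSeries.

(** * Expansion of [F] into monomials and conclusion *)

Theorem theorem3p2 (R : realType) (n r : nat) (F : {mpoly rat[n]})
    (hn : (0 < n)%N) (hF : mpdeg F = r) :
  let T := maxn ((r + n - 2) %/ 2) ((n - 1) %/ 2) in
  exists e : nat -> {poly rat},
    (forall l : nat, (l <= T)%N -> ((size (e l)).-1 <= r + n - 2 * l - 1)%N) /\
    (forall k : nat, (n <= k)%N ->
      \sum_(ks : {ffun 'I_n -> 'I_k.+1} |
              ((\sum_(j < n) (ks j : nat))%N == k) && [forall j, (1 <= ks j)%N])
         ratr F.@[fun j : 'I_n => (ks j : nat)%:R]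
           * \prod_(j < n) zeta R (2 * ks j)
      = \sum_(0 <= l < (minn T k).+1)
          ratr (e l).[k%:R] * zeta R (2 * l) * zeta R (2 * k - 2 * l)).
Proof.
move=> T.
pose S : pser R :=
  \sum_(m <- msupp F) qcst R F@_m * \prod_(j < n) Hser R (m j).
have : zform n (r + n) S.
  rewrite /S big_seq; apply: (big_ind (zform n (r + n))) => [|f g|m mF].
  - exact: zform_vanish.
  - exact: zform_add.
  apply/zform_qcst; apply: zform_leq (@zform_prod_Hser R n (fun j => m j) hn) => //.
  (* The exponents of a monomial of [F] sum to at most [r]. *)
  rewrite leq_add2r -mdegE -hF /mpdeg; have := msize_mdeg_lt mF.
  by case: (msize F).
case/zform_zeta => e [s v E]; exists e; split=> [l lT|k nk].
  by have := s l; lia.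
transitivity (S k).
  rewrite /S pser_sumE.
  under eq_bigr do rewrite mevalE rmorph_sum /= mulr_suml.
  rewrite exchange_big /=; apply: eq_bigr => m _.
  rewrite pserCE pser_prodE mulr_sumr big_mkcondr /=; apply: eq_bigr => ks _.
  case: ifP => [/forallP ks0|/negbT].
    rewrite rmorphM rmorph_prod /= -mulrA -big_split; congr (_ * _).
    apply: eq_bigr => j _; rewrite /Hser /= ifF; last first.
      by have := ks0 j; case: eqP => // ->.
    by rewrite rmorphXn /= ratr_nat.
  (* A tuple with some [k_j = 0] contributes nothing to the coefficient of [S], as [Hser] vanishes
     at 0. *)
  rewrite negb_forall => /existsP[j]; rewrite -eqn0Ngt => /eqP j0.
  by rewrite (bigD1 j) //= /Hser j0 eqxx mul0r mulr0.
rewrite E // big_mkord.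
rewrite [RHS](big_ord_widen k.+1 (fun l => ratr (e l).[k%:R] * zeta R (2 * l)
  * zeta R (2 * k - 2 * l))); last by rewrite ltnS geq_minr.
(* The sum given by [zform] runs up to [k]; beyond [T] both alternatives of its second clause fail,
   so [e l = 0]. *)
rewrite [RHS]big_mkcond; apply: eq_bigr => -[l /= lk] _.
case: ifPn => // lT; case: (eqVneq (e l) 0) => [->|/v].
  by rewrite horner0 rmorph0 !mul0r.
by move: lT; rewrite /T; lia.
Qed.
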